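(* Let $\mathcal{A}$ be a finite alphabet, $\mathbb{L}=\mathbb{Z}^-=\{\ldots,-2,-1,0\}$ and $\Omega=\mathcal{A}^{\mathbb{L}}$. For every regular left singleton-specification $f=\{f_i\}_{i\in\mathbb{L}}$ on $\Omega$ there exists an absolutely and uniformly summable potential $\phi=(\phi_A)_{A\in\mathcal{S}}$ such that, for each $i\in\mathbb{L}$ and $\omega\in\Omega$, $$f_i(\omega_i\mid\omega_{-\infty}^{i-1})=\frac{\displaystyle\sum_{\sigma_{i+1}^0\in\Omega_{i+1}^0}\exp\Big[-\sum_{A\in\mathcal{S}:\,A\cap[i,0]\neq\emptyset}\phi_A\big(\sigma_{i+1}^0\,\omega_{-\infty}^i\big)\Big]}{\displaystyle\sum_{\sigma_i^0\in\Omega_i^0}\exp\Big[-\sum_{A\in\mathcal{S}:\,A\cap[i,0]\neq\emptyset}\phi_A\big(\sigma_i^0\,\omega_{-\infty}^{i-1}\big)\Big]},$$ with the convention $\sigma_1^0\equiv\emptyset$ (for $i=0$ the numerator is the single term $\exp[-\sum_{A\ni 0}\phi_A(\omega)]$).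
   Context: $\mathcal{A}$ is finite with the discrete $\sigma$-algebra; $\Omega$ carries the product topology and product $\sigma$-algebra $\mathcal F$. $\mathcal{S}$ is the set of (nonempty) finite subsets of $\mathbb{L}$; $\mathcal{F}_A$ is the $\sigma$-algebra generated by the coordinates in $A$, $\mathcal{F}_{\le i}=\mathcal{F}_{(-\infty,i]}$. $\omega_k^n=\omega_{[k,n]}$, $\Omega_k^n=\mathcal{A}^{[k,n]}$, $\omega_{-\infty}^n=\omega_{(-\infty,n]}$; juxtaposition denotes concatenation of configurations on disjoint sets of sites. A left singleton-specification (LSS) $f$ is a family of probability kernels $\{f_i\}_{i\in\mathbb{L}}$, $f_i:\mathcal{F}_{\le i}\times\Omega\to[0,1]$, such that for all $i\in\mathbb L$: (a) for each $A\in\mathcal{F}_{\le i}$, $f_i(A\mid\cdot)$ is $\mathcal{F}_{\le i-1}$-measurable; (b) for each $B\in\mathcal{F}_{\le i-1}$ and $\omega\in\Omega$, $f_i(B\mid\omega)=\mathbf{1}_B(\omega)$. Here $f_i(\omega_i\mid\cdot)$ denotes the probability of the cylinder $\{\sigma:\sigma_i=\omega_i\}$. The LSS is regular if, for every $i\in\mathbb{L}$ and $\omega_i\in\mathcal{A}$, the function $f_i(\omega_i\mid\cdot)$ is continuous and strictly positive. A potential is a family $\phi=(\phi_A)_{A\in\mathcal{S}}$ of functions $\phi_A:\Omega\to\mathbb{R}$ with $\phi_A$ being $\mathcal{F}_A$-measurable; it is absolutely and uniformly summable if $\sum_{A\ni i}\|\phi_A\|_\infty<\infty$ for every $i\in\mathbb{L}$.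 *)

(* Defs.v *)
From HB Require Import structures.
From mathcomp Require Import all_boot all_order all_algebra finmap.
From mathcomp Require Import all_classical all_reals all_analysis.
From mathcomp Require Import measurable_realfun.

Set Implicit Arguments.
Unset Strict Implicit.
Unset Printing Implicit Defensive.

Import Order.TTheory GRing.Theory Num.Theory numFieldNormedType.Exports.
Local Open Scope classical_set_scope.
Local Open Scope ring_scope.

(** A finite alphabet is a nonempty finite type. The point plays no role beyond
    witnessing nonemptiness, which [measurableType] requires. *)
#[short(type="alphabetType")]
HB.structure Definition Alphabet := {T of Finite T & isPointed T}.

Record site := Site { site_val :> int; _ : site_val <= 0 }.
HB.instance Definition _ := [isSub for site_val].
HB.instance Definition _ := [Countable of site by <:].

(** The interval [k, n] of sites, empty when [n < k]; see [in_sitv]. *)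
Definition sitv (k n : int) : {fset site} :=
  fset_set [set j : site | k <= site_val j <= n].

Lemma finite_sitv (k n : int) :
  finite_set [set j : site | k <= site_val j <= n].
Proof.
have site0 : (0 : int) <= 0 by [].
apply: (@sub_finite_set _ _ ((fun m : nat => insubd (Site site0) (- m%:Z))
          @` `I_(`|k|%N).+1)); last exact/finite_image/finite_II.
move=> j /= /andP[kj _]; have j0 : site_val j <= 0 by case: j {kj}.
exists `|site_val j|%N; last first.
  apply/val_inj; rewrite val_insubd /=.
  have -> : - (`|site_val j|%N : int) = site_val j.
    by rewrite abszE ler0_norm// opprK.
  by rewrite j0.
have k0 : k <= 0 by exact: le_trans kj j0.
by rewrite /= ltnS -lez_nat !abszE !ler0_norm// lerN2.
Qed.

Lemma in_sitv (k n : int) (j : site) :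
  (j \in sitv k n) = (k <= site_val j <= n).
Proof.
by rewrite /sitv in_fset_set; [rewrite mem_setE | exact: finite_sitv].
Qed.

Definition fin_region := {A : {fset site} | A != fset0}.

Definition config (Alph : Type) := site -> Alph.

(** The product topology, with [Alph] discrete. *)
Notation config_top Alph :=
  (prod_topology (fun _ : site => discrete_topology Alph)).

(** Events depending on a single coordinate in [V]. *)
Definition coord_events (Alph : Type) (V : set site) : set (set (config Alph)) :=
  \bigcup_(j in V) preimage_set_system setT (fun w : config Alph => w j) setT.

(** Configurations with the sigma-algebra F_V generated by the coordinates in
    [V]; the product sigma-algebra is the case [V = setT]. *)
Notation config_on Alph V := (g_sigma_algebraType (@coord_events Alph V)).

Definition upto (k : int) : set site := [set j | site_val j <= k].

Notation sigma_upto Alph k := (@coord_events Alph (upto k)).-sigma.-measurable.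

Record LSS (R : realType) (Alph : alphabetType) := {
  lss_ker :> forall i : site,
    R.-pker (config_on Alph setT) ~> (config_on Alph (upto i)) ;
  lss_measurable : forall (i : site) (B : set (config Alph)),
    sigma_upto Alph i B ->
    measurable_fun [set: config_on Alph (upto (site_val i - 1))]
      (fun w : config_on Alph (upto (site_val i - 1)) => lss_ker i w B) ;
  lss_proper : forall (i : site) (B : set (config Alph)) (w : config Alph),
    sigma_upto Alph (site_val i - 1) B ->
    lss_ker i w B = (\1_B w : R)%:E }.

(** f_i(a | w) *)
Definition lss_prob (R : realType) (Alph : alphabetType) (f : LSS R Alph)
    (i : site) (a : Alph) (w : config Alph) : R :=
  fine (f i w [set s : config Alph | s i = a]).

Definition lss_regular (R : realType) (Alph : alphabetType) (f : LSS R Alph) :=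
  forall (i : site) (a : Alph),
    continuous (lss_prob f i a : config_top Alph -> R) /\
    forall w : config Alph, 0 < lss_prob f i a w.

Record potential (R : realType) (Alph : alphabetType) := {
  pot :> fin_region -> config Alph -> R ;
  pot_measurable : forall A : fin_region,
    measurable_fun [set: config_on Alph [set` val A]]
      (pot A : config_on Alph [set` val A] -> R) }.

Definition sup_norm (R : realType) (T : Type) (g : T -> R) : \bar R :=
  ereal_sup (range (fun w => `|g w|%:E)).

Definition summable_potential (R : realType) (Alph : alphabetType)
    (phi : potential R Alph) :=
  forall i : site,
    (\esum_(A in [set A : fin_region | i \in val A]) sup_norm (phi A) < +oo)%E.

(** Sum of an absolutely summable real family (a junk value otherwise). *)
Definition abs_sum (R : realType) (T : choiceType) (D : set T) (g : T -> R) : R :=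
  fine (esum D (EFin \o g)^\+ - esum D (EFin \o g)^\-)%E.

Definition energy (R : realType) (Alph : alphabetType) (phi : potential R Alph)
    (i : site) (w : config Alph) : R :=
  abs_sum [set A : fin_region | (val A `&` sitv i 0)%fset != fset0]
    (fun A => phi A w).

(** The concatenation of [s] on [k, n] with the restriction of [w] to the
    complement of [k, n]. *)
Definition concat (Alph : Type) (k n : int) (s : {ffun sitv k n -> Alph})
    (w : config Alph) : config Alph :=
  fun j => if (insub j : option (sitv k n)) is Some u then s u else w j.

(* Main.v *)
Require Import Defs.
From HB Require Import structures.
From mathcomp Require Import all_boot all_order all_algebra finmap.
From mathcomp Require Import all_classical all_reals all_analysis.
From mathcomp Require Import measurable_realfun.
From mathcomp Require Import zify lra.

Set Implicit Arguments.
Unset Strict Implicit.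
Unset Printing Implicit Defensive.

Import Order.TTheory GRing.Theory Num.Theory numFieldNormedType.Exports.
Local Open Scope classical_set_scope.
Local Open Scope ring_scope.

(** Let [g j w] be minus the logarithm of the conditional probability of the
    letter [w j] given the past of [j].  The lattice stops at [0], so a set
    meets [[i, 0]] exactly when its rightmost site is at least [i].  It is
    therefore enough to produce, for each [j] separately, functions carried by
    sets with rightmost site [j] whose sum is [g j]: the energy at [i] is then
    the sum of [g j] over [i <= j <= 0], the Boltzmann weight is the product of
    the conditional probabilities [f_j], and summing out the coordinates in
    [[i, 0]] gives [1].  Hence the denominator equals [1], and the numerator
    equals [f_i] because its factor at [i] does not see the summed coordinates.

    To decompose [g j], freeze the coordinates to the left of [j - N j n] to a
    reference letter.  The frozen function [G_n] depends on the window
    [[j - N j n, j]] alone, and [phi] on that window is [G_n - G_(n-1)], with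
    [G_(-1) = 0]; the sum over [n] telescopes to the limit [g j].  With
    [N j n = n] this would only give convergence.  Absolute summability is
    obtained by letting [N j] grow fast enough for [|G_n - g j|] to be at most
    [2 ^ - (n + 1)], which is possible since positivity and continuity of [f]
    make [g j] uniformly continuous on the compact space of configurations.  A
    site [i] belongs to windows with rightmost site in [[i, 0]] only, so the
    norms of the potential at [i] are bounded by finitely many geometric
    series.

    The analytic input is [cylinder_modulus] and [cylinder_bounded], the
    potential is built in [telescoping_summable] and [energy_telescoping], and
    the normalisation is [sum_concat_prod1]. *)

(** * Cylinders and compactness of the configuration space *)

Definition agree_from (T : Type) (k : int) (w w' : config T) :=
  forall j : site, k <= site_val j -> w j = w' j.

Lemma agree_from_le (T : Type) (m n : nat) (w v : config T) : (m <= n)%N ->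
  agree_from (- n%:Z) w v -> agree_from (- m%:Z) w v.
Proof. by move=> mn wv j jm; apply: wv; apply: le_trans jm; lia. Qed.

Lemma agree_from_trans (T : Type) k (w v u : config T) :
  agree_from k w v -> agree_from k v u -> agree_from k w u.
Proof. by move=> wv vu j jk; rewrite wv // vu. Qed.

Section CylinderTopology.
Variable Alph : alphabetType.

Lemma near_agree_from (w : config_top Alph) (m : nat) :
  \forall v \near w, agree_from (- m%:Z) w v.
Proof.
have Fw := nbhs_filter w.
have near1 (j : site) : \forall v \near w, w j = v j.
  have /cvg_sup/(_ j) h : nbhs w --> w by exact: cvg_id.
  apply: (h [set v : config Alph | w j = v j]).
  apply: open_nbhs_nbhs; split => //=.
  by exists [set w j]; [exact: discrete_open | apply/seteqP; split => v /= ->].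
have : \forall v \near w, forall j, j \in sitv (- m%:Z) 0 -> w j = v j.
  have := @filter_bigI _ site (sitv (- m%:Z) 0) (fun j => [set v | w j = v j])
    (nbhs w) Fw (fun j _ => near1 j).
  by move/filterS; apply => v /= h j jm; exact: h.
move=> H; apply: (filterS _ H) => v h j mj; apply: h; rewrite in_sitv mj /=.
by case: j {mj}.
Qed.

(** The cylinders around [w] generate a filter that converges to [w] in each
    coordinate, hence in the product topology; so they form a neighbourhood
    base. *)
Lemma nbhs_agree_from (w : config_top Alph) (A : set (config Alph)) :
  nbhs w A -> exists m : nat, forall v, agree_from (- m%:Z) w v -> A v.
Proof.
pose F : set_system (config Alph) :=
  filter_from [set: nat] (fun m => [set v | agree_from (- m%:Z) w v]).
have FF : Filter F.
  apply: filter_from_filter; first by exists 0%N.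
  move=> m n _ _; exists (maxn m n) => // v h.
  by split => j jm; apply: h; apply: le_trans jm; lia.
suff /(_ A) Fw : F --> w by move=> /Fw [m _ h]; exists m.
apply/cvg_sup => j B; rewrite nbhsE => -[C [[D oD <-] Dw] CB].
exists `|site_val j|%N => // v /= h; apply: CB => /=.
by rewrite -h //; lia.
Qed.

Lemma compact_config : compact [set: config_top Alph].
Proof.
have := @tychonoff site (fun _ => discrete_topology Alph) (fun _ => setT).
have -> : [set w : site -> discrete_topology Alph |
    forall i, [set: discrete_topology Alph] (w i)] = setT.
  by apply/seteqP; split.
apply => _; apply: finite_compact; exact: (@finite_finset Alph).
Qed.

(** A local-to-global principle: by compactness finitely many cylinders on
    which [P] holds cover the space, and monotonicity in the index lets the
    largest of the finitely many indices serve everywhere. *)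
Lemma cylinder_covering (P : nat -> config Alph -> Prop) :
  (forall m n v, (m <= n)%N -> P m v -> P n v) ->
  (forall w, exists m, forall v, agree_from (- m%:Z) w v -> P m v) ->
  exists m, forall v, P m v.
Proof.
move=> Pmono Ploc.
have /compact_near_coveringP := compact_config.
move=> /(_ nat \oo P _)[|N _ hN]; last first.
  by exists N => v; exact: (hN N (leqnn N) v I).
move=> w _; have [m hm] := Ploc w.
exists ([set v | agree_from (- m%:Z) w v], [set n | (m <= n)%N]) => /=.
  split; [exact: near_agree_from | by exists m].
by move=> [v n] /= [/hm + mn]; exact: Pmono.
Qed.

End CylinderTopology.

Section UniformContinuity.
Variables (R : realType) (Alph : alphabetType) (h : config Alph -> R).
Hypothesis h_cont : forall w (e : R), 0 < e ->
  exists m : nat, forall v, agree_from (- m%:Z) w v -> `|h w - h v| < e.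

(** Heine's theorem, with cylinders in place of an entourage. *)
Lemma cylinder_modulus (e : R) : 0 < e ->
  exists m : nat, forall w v, agree_from (- m%:Z) w v -> `|h w - h v| <= e.
Proof.
move=> e0.
apply: (@cylinder_covering _ (fun m w => forall v, agree_from (- m%:Z) w v ->
  `|h w - h v| <= e)) => [m n w mn hm v wv|w].
  by apply: hm; exact: agree_from_le wv.
have e20 : 0 < e / 2 by lra.
have [m hm] := h_cont w e20; exists m => v wv u vu.
have := hm v wv; have := hm u (agree_from_trans wv vu).
have -> : h v - h u = (h w - h u) - (h w - h v) by lra.
move=> h1 h2; apply: le_trans (ler_normB _ _) _; lra.
Qed.

Lemma cylinder_bounded : exists b : R, forall w, `|h w| <= b.
Proof.
have [m hm] : exists m : nat, forall w, `|h w| <= m%:R; last by exists m%:R.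
apply: (@cylinder_covering _ (fun m w => `|h w| <= m%:R)) => [m n w mn hm|w].
  by apply: le_trans hm _; rewrite ler_nat.
have [m hm] := h_cont w ltr01.
exists (maxn m (Num.bound (`|h w| + 1))) => v wv.
have /hm wv1 : agree_from (- m%:Z) w v.
  by apply: agree_from_le wv; exact: leq_maxl.
apply: (@le_trans _ _ (Num.bound (`|h w| + 1))%:R); last first.
  by rewrite ler_nat leq_maxr.
have b1 : 0 <= `|h w| + 1 by rewrite addr_ge0.
apply: ltW; apply: lt_trans (archi_boundP b1).
have -> : h v = h w - (h w - h v) by lra.
apply: le_lt_trans (ler_normB _ _) _; lra.
Qed.

End UniformContinuity.

(** * Functions measurable with respect to a set of coordinates *)

Section CoordinateEvents.
Variable Alph : alphabetType.

(** The sets that cannot separate two configurations agreeing on [V] form a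
    sigma-algebra containing the generators. *)
Lemma sigma_coord_agree (V : set site) (B : set (config Alph)) :
  (@coord_events Alph V).-sigma.-measurable B ->
  forall w w', (forall j, V j -> w j = w' j) -> B w -> B w'.
Proof.
move=> mB.
pose S := [set B : set (config Alph) | forall w w' : config Alph,
  (forall j, V j -> w j = w' j) -> (B w <-> B w')].
suff SB : S B by move=> w w' ww'; case: (SB w w' ww').
apply: (@smallest_sub _ (sigma_algebra setT) _ S) mB; last first.
  move=> C [j Vj [D _ <-]] w w' ww' /=.
  by rewrite /setI /= ww'.
split.
- by move=> w w' _; split.
- move=> C SC w w' ww'; rewrite /setD /=.
  by have [h1 h2] := SC w w' ww'; split => -[_ nC]; split=> //;
    [move=> /h2|move=> /h1].
- move=> F SF w w' ww'; split => -[n _ Fn]; exists n => //;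
  by have [h1 h2] := SF n w w' ww'; auto.
Qed.

Lemma measurable_fun_agree (R : realType) (V : set site)
    (h : config_on Alph V -> \bar R) : measurable_fun setT h ->
  forall w w' : config Alph, (forall j, V j -> w j = w' j) -> h w = h w'.
Proof.
move=> mh w w' ww'.
have := mh measurableT [set h w] (emeasurable_set1 _); rewrite setTI => mhw.
by have /(_ erefl)/= := sigma_coord_agree mhw ww'.
Qed.

Lemma coord_eq_measurable (V : set site) (j : site) (a : Alph) : V j ->
  measurable ([set w | w j = a] : set (config_on Alph V)).
Proof.
move=> Vj; apply: sub_sigma_algebra; exists j => //.
by exists [set a] => //; rewrite setTI.
Qed.

(** The alphabet being finite, a function of the coordinates in a finite set
    [A] has only finitely many patterns to distinguish, and each pattern on [A]
    is a finite intersection of coordinate events. *)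
Lemma local_measurable_fun (R : realType) (A : {fset site})
    (h : config Alph -> R) :
  (forall w w', (forall j, j \in A -> w j = w' j) -> h w = h w') ->
  measurable_fun [set: config_on Alph [set` A]]
    (h : config_on Alph [set` A] -> R).
Proof.
move=> hdep _ B mB; rewrite setTI.
pose D := [set s : {ffun A -> Alph} |
  exists2 w : config Alph, forall u : A, w (val u) = s u & B (h w)].
have -> : h @^-1` B =
    \bigcup_(s in D) \bigcap_(u in [set: A]) [set w | w (val u) = s u].
  apply/seteqP; split => [w Bhw|w [s [v vs Bhv] ws]] /=.
    exists [ffun u : A => w (val u)]; last by move=> u _ /=; rewrite ffunE.
    by exists w => // u; rewrite ffunE.
  rewrite (hdep w v) // => j jA.
  by rewrite -[j]/(val (Sub j jA : A)) vs; exact: ws.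
apply: fin_bigcup_measurable; first exact: finite_finset.
move=> s _; apply: fin_bigcap_measurable; first exact: finite_finset.
by move=> u _; apply: coord_eq_measurable; exact: (valP u).
Qed.

End CoordinateEvents.

Section LeftSpecification.
Variables (R : realType) (Alph : alphabetType) (f : LSS R Alph).

(** Measurability with respect to the strict past, read pointwise. *)
Lemma lss_prob_past (i : site) (a : Alph) (w w' : config Alph) :
  (forall j : site, site_val j <= site_val i - 1 -> w j = w' j) ->
  lss_prob f i a w = lss_prob f i a w'.
Proof.
move=> ww'; rewrite /lss_prob; congr fine.
have ma : sigma_upto Alph (site_val i) [set s | s i = a].
  by apply: coord_eq_measurable; rewrite /upto /=.
exact: (measurable_fun_agree (lss_measurable f ma) ww').
Qed.

Lemma lss_prob_sum1 (i : site) (w : config Alph) :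
  \sum_(a : Alph) lss_prob f i a w = 1.
Proof.
have ms (a : Alph) : measurable
    ([set s | s i = a] : set (config_on Alph (upto (site_val i)))).
  by apply: coord_eq_measurable; rewrite /upto /=.
have fin_a a : (lss_prob f i a w)%:E = f i w [set s | s i = a].
  rewrite /lss_prob fineK // ge0_fin_numE ?measure_ge0 //.
  apply: (@le_lt_trans _ _ 1%E); last exact: ltry.
  rewrite -(prob_kernel (s := f i) w); apply: le_measure => //.
    by rewrite inE; exact: ms.
  by rewrite inE; exact: measurableT.
apply: EFin_inj; rewrite -sumEFin -(prob_kernel (s := f i) w).
rewrite (_ : [set: _] = \bigcup_(a in [set: Alph])
  [set s : config_on Alph (upto (site_val i)) | s i = a]); last first.
  by apply/seteqP; split => // s _; exists (s i).
rewrite measure_fin_bigcup; first last.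
- by move=> a _; exact: ms.
- by move=> a b _ _ [s [/= -> ->]].
- exact: finite_finset.
rewrite (eq_bigr _ (fun a _ => fin_a a)).
have -> : [set: Alph] = [set` index_enum Alph].
  by apply/seteqP; split => // a _ /=; exact: mem_index_enum.
by rewrite -fsbig_seq // index_enum_uniq.
Qed.

End LeftSpecification.

(** * Summing out the coordinates in [[k, 0]] *)

Section Concatenation.
Variable Alph : Type.

Lemma concat_in (k n : int) (s : {ffun sitv k n -> Alph}) (w : config Alph)
  (u : sitv k n) : concat s w (val u) = s u.
Proof. by rewrite /concat valK. Qed.

Lemma concat_out (k n : int) (s : {ffun sitv k n -> Alph}) (w : config Alph)
  (j : site) : j \notin sitv k n -> concat s w j = w j.
Proof. by move=> jI; rewrite /concat insubF // (negbTE jI). Qed.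

End Concatenation.

Definition update (Alph : Type) (w : config Alph) (i : site) (a : Alph) :
  config Alph := fun j => if j == i then a else w j.

Lemma sitv_fsetU1 (i : site) :
  sitv (site_val i) 0 = (i |` sitv (site_val i + 1) 0)%fset.
Proof.
apply/fsetP => j; rewrite !inE !in_sitv -val_eqE /=.
by case: i j => i i0 [j j0] /=; lia.
Qed.

Lemma in_sitv_recl (i j : site) :
  (j \in sitv (site_val i) 0) = (j == i) || (j \in sitv (site_val i + 1) 0).
Proof. by rewrite sitv_fsetU1 !inE. Qed.

Lemma sum_concat_recl (R : nmodType) (Alph : alphabetType) (i : site)
    (w : config Alph) (F : config Alph -> R) :
  \sum_(s : {ffun sitv (site_val i) 0 -> Alph}) F (concat s w) =
  \sum_(a : Alph) \sum_(s : {ffun sitv (site_val i + 1) 0 -> Alph})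
    F (concat s (update w i a)).
Proof.
have iI : i \in sitv (site_val i) 0 by rewrite sitv_fsetU1 !inE eqxx.
have iJ : i \notin sitv (site_val i + 1) 0 by rewrite in_sitv; lia.
pose glue (p : Alph * {ffun sitv (site_val i + 1) 0 -> Alph}) :
  {ffun sitv (site_val i) 0 -> Alph} :=
  [ffun u => concat p.2 (fun=> p.1) (val u)].
pose split_first (s : {ffun sitv (site_val i) 0 -> Alph}) :
  Alph * {ffun sitv (site_val i + 1) 0 -> Alph} :=
  (s (Sub i iI), [ffun u => concat s w (val u)]).
rewrite pair_big /= (reindex glue) /=; last first.
  exists split_first => [[a s] _|s _].
    congr pair; first by rewrite ffunE /= concat_out.
    apply/ffunP => u; rewrite ffunE.
    have uI : val u \in sitv (site_val i) 0.
      by rewrite in_sitv_recl (valP u) orbT.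
    by rewrite -[val u in LHS]/(val (Sub (val u) uI : sitv _ _)) concat_in
      ffunE /= concat_in.
  apply/ffunP => u; rewrite ffunE /=.
  have := valP u; rewrite in_sitv_recl => /orP[/eqP ui|uJ].
    rewrite ui concat_out //; congr (s _); exact/val_inj.
  by rewrite -[val u in LHS]/(val (Sub (val u) uJ : sitv _ _)) concat_in
    ffunE /= concat_in.
apply: eq_bigr => -[a s] _; congr F; apply/funext => j /=.
have [jJ|jJ] := boolP (j \in sitv (site_val i + 1) 0).
  have jI : j \in sitv (site_val i) 0 by rewrite in_sitv_recl jJ orbT.
  rewrite -[j in LHS]/(val (Sub j jI : sitv _ _)) concat_in ffunE /=.
  by rewrite -[j]/(val (Sub j jJ : sitv _ _)) !concat_in.
rewrite [in RHS]concat_out // /update.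
have [->|ji] := eqVneq j i.
  by rewrite -[i in LHS]/(val (Sub i iI : sitv _ _)) concat_in
    ffunE /= concat_out.
by rewrite concat_out // sitv_fsetU1 !inE negb_or ji.
Qed.

(** Coordinates are summed out from the right: whatever the letter at the
    leftmost site [k], the sum over the sites of [[k + 1, 0]] is [1] by
    induction, and this leaves the sum over that letter of [p k], which is
    blind to the coordinates already summed. *)
Lemma sum_concat_prod1 (R : comNzRingType) (Alph : alphabetType)
    (p : site -> config Alph -> R) :
  (forall (j : site) w w',
     (forall x : site, site_val x <= site_val j -> w x = w' x) ->
     p j w = p j w') ->
  (forall (j : site) w, \sum_(a : Alph) p j (update w j a) = 1) ->
  forall (n : nat) (k : int) (w : config Alph), k = 1 - n%:Z ->
  \sum_(s : {ffun sitv k 0 -> Alph}) \prod_(j <- sitv k 0) p j (concat s w) = 1.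
Proof.
move=> pdep psum; elim=> [|n IH] k w kn.
  have I0 : sitv k 0 = fset0.
    by apply/fsetP => -[j j0]; rewrite in_sitv inE /=; lia.
  rewrite (eq_bigr (fun=> 1)) => [|s _]; last first.
    by rewrite big_seq big1 // => j; rewrite I0.
  (* the empty configuration is the only one on an empty set of sites *)
  rewrite sumr_const card_ffun.
  by rewrite -cardfE I0 cardfs0 expn0.
have k0 : k <= 0 by lia.
pose i := Site k0; rewrite -[k]/(site_val i).
rewrite (sum_concat_recl i w (fun v => \prod_(j <- sitv (site_val i) 0) p j v)).
rewrite -[RHS](psum i w); apply: eq_bigr => a _.
have iJ : i \notin sitv (site_val i + 1) 0 by rewrite in_sitv /=; lia.
have sum1 := IH (site_val i + 1) (update w i a).
rewrite -[RHS]mulr1 -[X in _ = _ * X]sum1 /=; last by lia.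
rewrite mulr_sumr; apply: eq_bigr => s _.
have -> : sitv k 0 = (i |` sitv (k + 1) 0)%fset by exact: (sitv_fsetU1 i).
rewrite big_fsetU1 //=; congr (_ * _).
apply: pdep => x xi; apply: concat_out; rewrite in_sitv /=; move: xi => /=; lia.
Qed.

(** * Absolutely summable series with geometric majorants *)

Section GeometricSeries.
Variable R : realType.

Lemma esum_geometric_lt (h : nat -> \bar R) (C : R) :
  (forall n, (0 <= h n)%E) ->
  (forall n, (h n <= (C / (2 ^ n.+1)%:R)%:E)%E) ->
  (\esum_(n in setT) h n < +oo)%E.
Proof.
move=> h0 hC; have C0 : 0 <= C.
  have := le_trans (h0 0%N) (hC 0%N); rewrite lee_fin.
  by rewrite pmulr_lge0 // invr_gt0 ltr0n expn_gt0.
rewrite -nneseries_esumT //.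
apply: (@le_lt_trans _ _ (C%:E)); last exact: ltry.
apply: le_trans (epsilon_trick0 xpredT C0).
by apply: lee_nneseries => // n _; exact: hC.
Qed.

(** Absolute convergence makes the unordered sum, split into positive and
    negative parts, agree with the limit of the partial sums; the telescoping
    sum is only accessible in the second form. *)
Lemma esum_posneg_cvg (u : nat -> R) (C l : R) :
  (forall n, `|u n| <= C / (2 ^ n.+1)%:R) ->
  \sum_(0 <= k < n) u k @[n --> \oo] --> l ->
  (esum [set: nat] (EFin \o u)^\+ - esum [set: nat] (EFin \o u)^\- = l%:E)%E.
Proof.
move=> uC ul.
have su : summable [set: nat] (EFin \o u).
  by apply: (@esum_geometric_lt _ C) => // n; rewrite /= lee_fin.
have eT : (fun n : nat => is_true (xpredT n)) = setT by apply/seteqP; split.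
rewrite -eT in su *; rewrite -summable_eseries_esum //.
apply: cvg_lim => //.
rewrite (_ : (fun n => _) = EFin \o (fun n => \sum_(0 <= k < n) u k)); last first.
  by apply/funext => n /=; rewrite sumEFin.
exact: (cvg_comp _ _ ul).
Qed.

End GeometricSeries.

(** Partial sums of the successors of any admissible choice are admissible and
    strictly increasing. *)
Lemma increasing_cutoffs (P : nat -> nat -> Prop) :
  (forall n m m', (m <= m')%N -> P n m -> P n m') ->
  (forall n, exists m, P n m) ->
  exists N : nat -> nat, (forall n, (N n < N n.+1)%N) /\ forall n, P n (N n).
Proof.
move=> Pmono /choice [M PM].
exists (fun n => \sum_(k < n.+1) (M k).+1)%N; split => n.
  by rewrite [ltnRHS]big_ord_recr /=; lia.
by apply: Pmono (PM n); rewrite big_ord_recr /=; lia.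
Qed.

(** * The telescoping potential of a family of local energies *)

Section TelescopingPotential.
Variables (R : realType) (Alph : alphabetType).
Variable g : site -> config Alph -> R.
Hypothesis g_past : forall (j : site) w w',
  (forall x : site, site_val x <= site_val j -> w x = w' x) -> g j w = g j w'.
Variable B : site -> R.
Hypothesis g_bounded : forall j w, `|g j w| <= B j.
Variable N : site -> nat -> nat.
Hypothesis N_incr : forall j n, (N j n < N j n.+1)%N.
Hypothesis N_modulus : forall j n w w',
  agree_from (- (N j n)%:Z) w w' -> `|g j w - g j w'| <= (2 ^ n.+1)%:R^-1.

Let left_end (j : site) (n : nat) : int := site_val j - (N j n)%:Z.

(** The past of [k] is frozen to the reference letter [point]. *)
Definition cut (k : int) (w : config Alph) : config Alph :=
  fun j => if k <= site_val j then w j else point.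

(** The index is shifted by one with respect to [N], so that the first partial
    energy is [0] and the first increment is a frozen energy itself. *)
Definition partial_energy (j : site) (n : nat) (w : config Alph) : R :=
  if n is m.+1 then g j (cut (left_end j m) w) else 0.

Definition increment (p : site * nat) (w : config Alph) : R :=
  partial_energy p.1 p.2.+1 w - partial_energy p.1 p.2 w.

Definition window (p : site * nat) : {fset site} :=
  sitv (left_end p.1 p.2) (site_val p.1).

Lemma window_neq0 p : window p != fset0.
Proof.
by apply/fset0Pn; exists p.1; rewrite in_sitv lexx andbT /left_end; lia.
Qed.

Definition region (p : site * nat) : fin_region :=
  exist _ (window p) (window_neq0 p).

Lemma N_le j m n : (m <= n)%N -> (N j m <= N j n)%N.
Proof.
by apply: (@homo_leq _ (N j) leq) => // [|n']; [exact: leq_trans | exact: ltnW].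
Qed.

(** Both partial energies are functions on the window: the wider one by
    construction, the narrower one because [N j] increases.  Sites to the
    right of [j] are invisible to [g j]. *)
Lemma increment_window j n w w' : (forall x, x \in window (j, n) -> w x = w' x) ->
  increment (j, n) w = increment (j, n) w'.
Proof.
move=> ww'; have key m : (m <= n)%N ->
    g j (cut (left_end j m) w) = g j (cut (left_end j m) w').
  move=> /(N_le j) mn; apply: g_past => x xj; rewrite /cut.
  case: ifPn => // mx; apply: ww'; rewrite in_sitv xj andbT.
  by apply: le_trans mx; rewrite /left_end /=; lia.
rewrite /increment /= key //; case: n key {ww'} => //= n key.
by rewrite key.
Qed.

(** A window has rightmost site [j] and leftmost site [j - N j n], and the
    latter determines [n] since [N j] is strictly increasing. *)
Lemma region_inj : injective region.
Proof.
move=> [j m] [j' m'] /(congr1 val) /= /fsetP E.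
have jj' : j = j'.
  have top (l : site) (k : nat) : site_val l - k%:Z <= site_val l by lia.
  apply/val_inj/le_anti => /=; apply/andP; split.
    have := E j; rewrite !in_sitv /left_end /= lexx andbT => /esym.
    by rewrite top => /andP[].
  have := E j'; rewrite !in_sitv /left_end /= lexx andbT.
  by rewrite top => /andP[].
subst j'; congr pair.
have low n : site_val j - (N j n)%:Z <= 0 by case: j {E} => j /=; lia.
have Nmm' : N j m = N j m'.
  have := E (Site (low m')); have := E (Site (low m)).
  rewrite !in_sitv /left_end /= !lexx /= !gerBl /= !andbT => /esym h1 h2.
  by move: h1 h2; lia.
have [mm'|mm'|//] := ltngtP m m'.
- by have := N_incr j m; have := N_le j mm'; lia.
- by have := N_incr j m'; have := N_le j mm'; lia.
Qed.

(** The indices [p] with [region p = A] are at most one, so this is the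
    increment of the window [A], and [0] when [A] is not a window. *)
Definition telescoping_fun (A : fin_region) (w : config Alph) : R :=
  \sum_(p \in [set p | region p = A]) increment p w.

Lemma telescoping_region p w : telescoping_fun (region p) w = increment p w.
Proof.
rewrite /telescoping_fun (_ : [set _ | _] = [set p]) ?fsbig_set1 //.
by apply/seteqP; split => [q /= /region_inj|q /= ->].
Qed.

Lemma telescoping_out A w : ~ range region A -> telescoping_fun A w = 0.
Proof.
move=> nA; rewrite /telescoping_fun (_ : [set _ | _] = set0) ?fsbig_set0 //.
by apply/seteqP; split => // p /= pA; apply: nA; exists p.
Qed.

Lemma telescoping_measurable (A : fin_region) :
  measurable_fun [set: config_on Alph [set` val A]]
    (telescoping_fun A : config_on Alph [set` val A] -> R).
Proof.
apply: local_measurable_fun => w w' ww'.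
have [[[j n] _ jnA]|nA] := pselect (range region A);
  last by rewrite !telescoping_out.
rewrite -jnA !telescoping_region; apply: increment_window => x xI; apply: ww'.
by rewrite -jnA.
Qed.

Definition telescoping_potential : potential R Alph :=
  {| pot := telescoping_fun; pot_measurable := telescoping_measurable |}.

Lemma g_cut j n w : `|g j (cut (left_end j n) w) - g j w| <= (2 ^ n.+1)%:R^-1.
Proof.
apply: N_modulus => x xn; rewrite /cut ifT //.
apply: le_trans xn; rewrite /left_end; case: j => j /=; lia.
Qed.

(** For [n = 0] the increment is bounded by [B j], whence the term [2 * B j];
    for [n > 0] the two frozen energies are within [2 ^ - (n + 1)] and
    [2 ^ - n] of [g j], and these add up to [3 / 2 ^ (n + 1)]. *)
Lemma increment_bound j n w :
  `|increment (j, n) w| <= (3 + 2 * B j) / (2 ^ n.+1)%:R.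
Proof.
have B0 : 0 <= B j by exact: le_trans (g_bounded j w).
rewrite /increment /=; case: n => [|n].
  rewrite subr0 expn1; apply: le_trans (g_bounded _ _) _; lra.
have := g_cut j n w; have := g_cut j n.+1 w.
set a := g j (cut _ w); set b := g j (cut _ w) => ha hb.
have e0 : 0 < (2 ^ n.+2)%:R^-1 :> R by rewrite invr_gt0 ltr0n expn_gt0.
have e2 : (2 ^ n.+1)%:R^-1 = 2 * (2 ^ n.+2)%:R^-1 :> R.
  by rewrite (expnS 2 n.+1) natrM invfM mulrA divff // mul1r.
move: ha hb; rewrite /= e2; move: e0; set e := _^-1 => e0 ha hb.
have : `|a - b| <= 3 * e.
  have -> : a - b = (a - g j w) - (b - g j w) by lra.
  apply: le_trans (ler_normB _ _) _; lra.
move/le_trans; apply; nra.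
Qed.

Lemma increment_cvg j w :
  \sum_(0 <= n < m) increment (j, n) w @[m --> \oo] --> g j w.
Proof.
have -> : (fun m => \sum_(0 <= n < m) increment (j, n) w) =
    (fun m => partial_energy j m w).
  apply/funext => m.
  rewrite (@telescope_sumr _ 0 m (fun n => partial_energy j n w)) //=.
  by rewrite subr0.
rewrite -cvg_shiftS /=; apply/cvgrPdist_le => e e0.
near=> n.
rewrite distrC; apply: le_trans (g_cut j n w) _.
near: n.
have [k _ hk] := near_infty_natSinv_lt (PosNum e0).
exists k => // n /hk /= /ltW; apply: le_trans.
rewrite lef_pV2 ?posrE ?ltr0n ?expn_gt0 // ler_nat.
by apply: ltnW; apply: leq_trans (ltn_expl _ _).
Unshelve. all: by end_near. Qed.

Lemma region_meets p (i : site) :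
  (window p `&` sitv (site_val i) 0)%fset != fset0 = (site_val i <= site_val p.1).
Proof.
apply/fset0Pn/idP => [[x]|ip].
  by rewrite !inE !in_sitv; case/and3P; lia.
exists p.1; rewrite !inE !in_sitv /left_end; case: p ip => -[j j0] n /=; lia.
Qed.

(** Summing over the sets that meet [[i, 0]] is summing over the windows with
    rightmost site in [[i, 0]]: finitely many sites [j], and one series for
    each of them. *)
Lemma esum_regions (i : site) (h : fin_region -> \bar R) :
  (forall A, (0 <= h A)%E) -> (forall A, ~ range region A -> h A = 0%E) ->
  (\esum_(A in [set A | (val A `&` sitv (site_val i) 0)%fset != fset0]) h A =
   \sum_(j <- sitv (site_val i) 0) \esum_(n in setT) h (region (j, n)))%E.
Proof.
move=> h0 hout.
set D := [set A | _].
have -> : esum D h = esum (D `&` range region) h.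
  rewrite esum_mkcondr; apply: eq_esum => A _; case: ifPn => // nA.
  by apply: hout => rA; move/negP: nA; apply; rewrite inE.
have -> : D `&` range region =
    region @` ([set` sitv (site_val i) 0] `*`` (fun=> [set: nat])).
  apply/seteqP; split => [A [DA [p _ pA]]|A [p [pi _] <-]].
    exists p => //; split => //=; move: DA; rewrite /D /= -pA region_meets.
    by rewrite in_sitv; case: p {pA} => -[j j0] n /= -> .
  split; last by exists p.
  by move: pi; rewrite /D /= region_meets in_sitv => /andP[].
rewrite esum_image; last by move=> p q _ _; exact: region_inj.
rewrite (@eq_esum _ _ _ _ (fun k => h (region (k.1, k.2)))); last by case.
rewrite -(@esum_esum _ _ _ _ (fun=> setT) (fun j n => h (region (j, n)))) //.
rewrite esum_fset //; last by move=> j _; exact: esum_ge0.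
by rewrite -fsbig_seq ?fset_uniq.
Qed.

(** The sets that contain [i] are among those that meet [[i, 0]]. *)
Lemma telescoping_summable : summable_potential telescoping_potential.
Proof.
move=> i; pose nrm (A : fin_region) := sup_norm (telescoping_fun A).
have nrm0 A : (0 <= nrm A)%E.
  apply: (@le_trans _ _ `|telescoping_fun A (fun=> point)|%:E).
    by rewrite lee_fin.
  by apply: ereal_sup_ubound; exists (fun=> point).
apply: (@le_lt_trans _ _
  (\esum_(A in [set A : fin_region |
     (val A `&` sitv (site_val i) 0)%fset != fset0]) nrm A)%E).
  rewrite esum_mkcond [leRHS]esum_mkcond; apply: le_esum => A _.
  case: ifPn => [iA|_]; last by case: ifP.
  rewrite ifT //; rewrite inE /=; apply/fset0Pn; exists i.
  by rewrite inE in_sitv lexx; move: iA; rewrite inE /= => ->; case: i.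
rewrite esum_regions // => [|A nA]; last first.
  apply/eqP; rewrite eq_le nrm0 andbT.
  by apply: ge_ereal_sup => _ [w _ <-]; rewrite telescoping_out // normr0.
rewrite lte_sum_pinfty // => j _.
apply: (@esum_geometric_lt _ _ (3 + 2 * B j)) => // n.
apply: ge_ereal_sup => _ [w _ <-]; rewrite lee_fin telescoping_region.
exact: increment_bound.
Qed.

Lemma energy_telescoping i w :
  energy telescoping_potential (site_val i) w =
  \sum_(j <- sitv (site_val i) 0) g j w.
Proof.
rewrite /energy /abs_sum.
rewrite !esum_regions; first last.
- by move=> A nA; rewrite funeposE /= telescoping_out // maxxx.
- by move=> A; rewrite funeposE le_max lexx orbT.
- by move=> A nA; rewrite funenegE /= telescoping_out // oppr0 maxxx.
- by move=> A; rewrite funenegE le_max lexx orbT.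
pose v j n := increment (j, n) w.
pose P j := (esum [set: nat] (EFin \o v j)^\+)%E.
pose M j := (esum [set: nat] (EFin \o v j)^\-)%E.
have bnd j n : `|v j n| <= (3 + 2 * B j) / (2 ^ n.+1)%:R.
  exact: increment_bound.
have Pfin j : P j \is a fin_num.
  rewrite ge0_fin_numE; last first.
    by apply: esum_ge0 => n _; rewrite funeposE le_max lexx orbT.
  apply: (@esum_geometric_lt _ _ (3 + 2 * B j)) => n; rewrite funeposE.
    by rewrite le_max lexx orbT.
  rewrite ge_max !lee_fin (le_trans (ler_norm _) (bnd j n)) /=.
  exact: le_trans (bnd j n).
have Mfin j : M j \is a fin_num.
  rewrite ge0_fin_numE; last first.
    by apply: esum_ge0 => n _; rewrite funenegE le_max lexx orbT.
  apply: (@esum_geometric_lt _ _ (3 + 2 * B j)) => n; rewrite funenegE.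
    by rewrite le_max lexx orbT.
  rewrite ge_max !lee_fin; apply/andP; split; last exact: le_trans (bnd j n).
  by apply: le_trans (bnd j n); rewrite -normrN ler_norm.
rewrite (eq_bigr P) => [|j _]; last first.
  by apply: eq_esum => n _; rewrite !funeposE /= telescoping_region.
rewrite [X in (_ - X)%E](eq_bigr M) => [|j _]; last first.
  by apply: eq_esum => n _; rewrite !funenegE /= telescoping_region.
rewrite -(EFin_sum_fine _ (fun j _ => Pfin j)).
rewrite -(EFin_sum_fine _ (fun j _ => Mfin j)).
rewrite -EFinB /= -sumrB; apply: eq_bigr => j _.
rewrite -fineB // /P /M (esum_posneg_cvg (bnd j) (@increment_cvg j w)) //.
Qed.

End TelescopingPotential.

(** * Logarithms of the conditional probabilities *)

Section LogProbability.
Variables (R : realType) (Alph : alphabetType) (f : LSS R Alph).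
Hypothesis hf : lss_regular f.

Definition neg_log_prob (j : site) (w : config Alph) : R :=
  - ln (lss_prob f j (w j) w).

Lemma expR_neg_log_prob j w : expR (- neg_log_prob j w) = lss_prob f j (w j) w.
Proof. by rewrite opprK lnK // posrE; have [_] := hf j (w j); exact. Qed.

Lemma neg_log_prob_past (j : site) (w w' : config Alph) :
  (forall x : site, site_val x <= site_val j -> w x = w' x) ->
  neg_log_prob j w = neg_log_prob j w'.
Proof.
move=> ww'; rewrite /neg_log_prob ww' //; congr (- ln _).
by apply: lss_prob_past => x xj; apply: ww'; lia.
Qed.

(** The letter [w j] is itself a coordinate of the configuration, so the
    cylinder must reach as far as [j] for the regularity of one function
    [lss_prob f j a] to apply. *)
Lemma neg_log_prob_continuous (j : site) (w : config Alph) (e : R) : 0 < e ->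
  exists m : nat, forall v, agree_from (- m%:Z) w v ->
    `|neg_log_prob j w - neg_log_prob j v| < e.
Proof.
move=> e0; have [fcont fpos] := hf j (w j).
have lnf : ln (lss_prob f j (w j) v) @[v --> (w : config_top Alph)]
    --> ln (lss_prob f j (w j) w).
  by apply: continuous_comp; [exact: fcont | exact/continuous_ln/fpos].
have Fw : Filter (nbhs (w : config_top Alph)) := nbhs_filter _.
move/cvgrPdist_lt: lnf => /(_ e e0) lnf.
have [m hm] := nbhs_agree_from lnf.
exists (maxn m `|site_val j|%N) => v wv.
have wvj : w j = v j by apply: wv; lia.
rewrite /neg_log_prob -wvj -opprD normrN.
by apply: hm; apply: agree_from_le wv; exact: leq_maxl.
Qed.

Lemma sum_lss_prob_update (j : site) (w : config Alph) :
  \sum_(a : Alph) lss_prob f j (update w j a j) (update w j a) = 1.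
Proof.
rewrite -(lss_prob_sum1 f j w); apply: eq_bigr => a _.
rewrite {1}/update eqxx; apply: lss_prob_past => x xj; rewrite /update.
by case: eqP xj => // ->; lia.
Qed.

Lemma sum_lss_prob_concat (k : int) (w : config Alph) : k <= 1 ->
  \sum_(s : {ffun sitv k 0 -> Alph})
    \prod_(j <- sitv k 0) lss_prob f j (concat s w j) (concat s w) = 1.
Proof.
move=> k1.
apply: (@sum_concat_prod1 _ _ (fun j v => lss_prob f j (v j) v) _ _ `|1 - k|%N).
- move=> j v v' vv'; rewrite vv' //.
  by apply: lss_prob_past => x xj; apply: vv'; lia.
- exact: sum_lss_prob_update.
- by lia.
Qed.

End LogProbability.

Theorem corollary1 (R : realType) (Alph : alphabetType) (f : LSS R Alph)
  (hf : lss_regular f) :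
  exists phi : potential R Alph,
    summable_potential phi /\
    forall (i : site) (w : config Alph),
      lss_prob f i (w i) w =
        (\sum_(s : {ffun sitv (site_val i + 1) 0 -> Alph})
            expR (- energy phi i (concat s w))) /
        (\sum_(s : {ffun sitv (site_val i) 0 -> Alph})
            expR (- energy phi i (concat s w))).
Proof.
pose g := neg_log_prob f.
have /choice [B gB] : forall j, exists b : R, forall w, `|g j w| <= b.
  by move=> j; exact: (cylinder_bounded (neg_log_prob_continuous hf j)).
have /choice [N Nincr_mod] : forall j, exists M : nat -> nat,
    (forall n, (M n < M n.+1)%N) /\
    forall n w v, agree_from (- (M n)%:Z) w v ->
      `|g j w - g j v| <= (2 ^ n.+1)%:R^-1.
  move=> j.
  apply: (@increasing_cutoffs (fun n m => forall w v,
    agree_from (- m%:Z) w v -> `|g j w - g j v| <= (2 ^ n.+1)%:R^-1)).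
    by move=> n m m' mm' hm w v wv; apply: hm; exact: agree_from_le wv.
  move=> n; apply: (cylinder_modulus (neg_log_prob_continuous hf j)).
  by rewrite invr_gt0 ltr0n expn_gt0.
have Nincr j := (Nincr_mod j).1; have Nmod j := (Nincr_mod j).2.
have gpast := @neg_log_prob_past _ _ f.
exists (telescoping_potential gpast Nincr).
split; first exact: (telescoping_summable gpast gB Nincr Nmod).
move=> i w; have i0 : site_val i <= 0 by case: i.
have weight v : expR (- energy (telescoping_potential gpast Nincr) i v) =
    \prod_(j <- sitv (site_val i) 0) lss_prob f j (v j) v.
  rewrite (energy_telescoping gpast gB Nincr Nmod) -sumrN expR_sum.
  by apply: eq_bigr => j _; exact: expR_neg_log_prob.
under eq_bigr do rewrite weight.
under [in X in _ / X]eq_bigr do rewrite weight.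
rewrite (sum_lss_prob_concat f) ?divr1; last by lia.
have iJ : i \notin sitv (site_val i + 1) 0 by rewrite in_sitv; lia.
(* the factor at [i] leaves the sum: [concat s w] equals [w] up to [i] *)
rewrite (eq_bigr (fun s => lss_prob f i (w i) w *
  \prod_(j <- sitv (site_val i + 1) 0)
    lss_prob f j (concat s w j) (concat s w))).
  by rewrite -mulr_sumr (sum_lss_prob_concat f) ?mulr1 //; lia.
move=> s _; rewrite sitv_fsetU1 big_fsetU1 //=; congr (_ * _).
rewrite concat_out //; apply: lss_prob_past => x xi.
by apply: concat_out; rewrite in_sitv; lia.
Qed.
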